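(* Let $n\in\mathbb{N}\setminus\{0\}$ and, for each $i\in\{1,\dots,n\}$, let $(X_i,d_i,W_i)$ be a $UCW$-hyperbolic space. Put $X:=\prod_{i=1}^n X_i$ and, for $x=(x_1,\dots,x_n)$, $y=(y_1,\dots,y_n)\in X$ and $\lambda\in[0,1]$, define $d(x,y):=\left(\sum_{i=1}^n d_i^2(x_i,y_i)\right)^{1/2}$ and $W(x,y,\lambda):=(W_1(x_1,y_1,\lambda),\dots,W_n(x_n,y_n,\lambda))$. Then $(X,d,W)$ is a $UCW$-hyperbolic space.
   Context: A $W$-hyperbolic space is a triple $(X,d,W)$ where $(X,d)$ is a metric space and $W:X^2\times[0,1]\to X$ is such that, for all $x,y,z,w\in X$ and $\lambda,\mu\in[0,1]$: (W1) $d(z,W(x,y,\lambda))\le(1-\lambda)d(z,x)+\lambda d(z,y)$; (W2) $d(W(x,y,\lambda),W(x,y,\mu))=|\lambda-\mu|d(x,y)$; (W3) $W(x,y,\lambda)=W(y,x,1-\lambda)$; (W4) $d(W(x,z,\lambda),W(y,w,\lambda))\le(1-\lambda)d(x,y)+\lambda d(z,w)$. One writes $\frac{x+y}{2}$ for $W(x,y,\frac12)$, and $d^2(x,y)$ for $(d(x,y))^2$. A modulus of uniform convexity for a $W$-hyperbolic space $(X,d,W)$ is a function $\eta:(0,\infty)\times(0,2]\to(0,1]$ such that, for any $r>0$, any $\varepsilon\in(0,2]$ and any $a,x,y\in X$ with $d(x,a)\le r$, $d(y,a)\le r$, $d(x,y)\ge\varepsilon r$, we have $d\left(\frac{x+y}{2},a\right)\le(1-\eta(r,\varepsilon))r$.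 The modulus is monotone if, for any $r,s>0$ with $s\le r$ and any $\varepsilon\in(0,2]$, $\eta(r,\varepsilon)\le\eta(s,\varepsilon)$. A $UCW$-hyperbolic space is a $W$-hyperbolic space that admits a monotone modulus of uniform convexity. *)

(* Defs.v *)
From HB Require Import structures.
From mathcomp Require Import all_boot all_order all_algebra.
From mathcomp Require Import reals.

Set Implicit Arguments.
Unset Strict Implicit.
Unset Printing Implicit Defensive.

Import Order.TTheory GRing.Theory Num.Theory.
Local Open Scope ring_scope.

(* A predicate on distance functions rather than MathComp-Analysis's bundled
   [metricType], so that "the l2 distance on a product is a metric" can be part
   of a conclusion about a given distance function; the clauses other than
   [metric_ge0] are the fields of the factory [isMetric]. *)
Record is_metric (R : realType) (T : Type) (d : T -> T -> R) : Prop := {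
  metric_ge0 : forall x y, 0 <= d x y;
  metric_refl : forall x, d x x = 0;
  metric_pos : forall x y, d x y = 0 -> x = y;
  metric_symm : forall x y, d x y = d y x;
  metric_tri : forall y x z, d x z <= d x y + d y z
}.

(* [W x y l] is meaningful only for l in [0, 1]; its values at other l are
   left unconstrained. *)
Record is_W_hyperbolic (R : realType) (T : Type)
    (d : T -> T -> R) (W : T -> T -> R -> T) : Prop := {
  W_metric : is_metric d;
  W1 : forall (x y z : T) (l : R), 0 <= l <= 1 ->
    d z (W x y l) <= (1 - l) * d z x + l * d z y;
  W2 : forall (x y : T) (l m : R), 0 <= l <= 1 -> 0 <= m <= 1 ->
    d (W x y l) (W x y m) = `|l - m| * d x y;
  W3 : forall (x y : T) (l : R), 0 <= l <= 1 ->
    W x y l = W y x (1 - l);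
  W4 : forall (x y z w : T) (l : R), 0 <= l <= 1 ->
    d (W x z l) (W y w l) <= (1 - l) * d x y + l * d z w
}.

Definition midpoint (R : realType) (T : Type) (W : T -> T -> R -> T)
  (x y : T) : T := W x y (1 / 2).

(* A function (0, oo) x (0, 2] -> (0, 1] is represented by a total
   [eta : R -> R -> R], constrained only on (0, oo) x (0, 2]. *)
Record is_UC_modulus (R : realType) (T : Type) (d : T -> T -> R)
    (W : T -> T -> R -> T) (eta : R -> R -> R) : Prop := {
  UC_modulus_range : forall r e : R, 0 < r -> 0 < e <= 2 -> 0 < eta r e <= 1;
  UC_modulus_le : forall (r e : R) (a x y : T), 0 < r -> 0 < e <= 2 ->
    d x a <= r -> d y a <= r -> e * r <= d x y ->
    d (midpoint W x y) a <= (1 - eta r e) * r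
}.

Definition monotone_modulus (R : realType) (eta : R -> R -> R) : Prop :=
  forall r s e : R, 0 < r -> 0 < s -> s <= r -> 0 < e <= 2 ->
    eta r e <= eta s e.

Definition is_UCW_hyperbolic (R : realType) (T : Type)
    (d : T -> T -> R) (W : T -> T -> R -> T) : Prop :=
  is_W_hyperbolic d W /\
  exists eta : R -> R -> R, is_UC_modulus d W eta /\ monotone_modulus eta.

Definition prod_dist (R : realType) (n : nat) (X : 'I_n -> Type)
    (d : forall i, X i -> X i -> R) (x y : forall i, X i) : R :=
  Num.sqrt (\sum_(i < n) d i (x i) (y i) ^+ 2).

Definition prod_W (R : realType) (n : nat) (X : 'I_n -> Type)
    (W : forall i, X i -> X i -> R -> X i) (x y : forall i, X i) (l : R) :
    forall i, X i :=
  fun i => W i (x i) (y i) l.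

(* Main.v *)
Require Import Defs.
From mathcomp Require Import all_boot all_order all_algebra.
From mathcomp Require Import reals.
From mathcomp Require Import boolp ring lra.

(** The metric and convexity axioms of the product follow from those of the
    factors because the Euclidean norm on R^n is monotone on nonnegative
    vectors, positively homogeneous and satisfies Minkowski's inequality.

    For uniform convexity, let d(x,a), d(y,a) <= r and d(x,y) >= e r, and write
    m for the midpoint of x and y.  In some coordinate i one has
    d_i(x_i,y_i) >= (e/n) r.  Put p = d_i(x_i,a_i), q = d_i(y_i,a_i) and
    s = max(p,q), so that (e/n) r / 2 <= s <= r.  Uniform convexity of the i-th
    factor at radius s, together with monotonicity of its modulus, gives
    d_i(m_i,a_i) <= (1 - h) s with h = eta_i(r, e/n).  This and
    d_i(m_i,a_i) <= (p + q)/2 improve the inequality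
    d_i(m_i,a_i)^2 <= (p^2 + q^2)/2, valid in every coordinate, by the amount
    h^2 s^2 / 4 ([midpoint_sqr_gain]): if p and q are far apart the gain comes
    from the parallelogram identity, otherwise from the modulus.  Summing over
    the coordinates, d(m,a)^2 <= (1 - h^2 (e/n)^2 / 16) r^2, hence
    d(m,a) <= (1 - h^2 (e/n)^2 / 32) r.  Replacing h by the product of the
    eta_j(r, e/n) over all j makes the bound independent of i and keeps it
    monotone in r. *)

Set Implicit Arguments.
Unset Strict Implicit.
Unset Printing Implicit Defensive.

Import Order.TTheory GRing.Theory Num.Theory.
Local Open Scope ring_scope.

(** * The Euclidean norm *)

(** The Euclidean norm of a finite real family; [prod_dist d x y] is by
    definition the norm of the family of coordinate distances. *)
Definition l2norm (R : realType) (n : nat) (u : 'I_n -> R) : R :=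
  Num.sqrt (\sum_(i < n) u i ^+ 2).

Section L2norm.
Variables (R : realType) (n : nat).
Implicit Types u v : 'I_n -> R.

Lemma sum_sqr_ge0 u : 0 <= \sum_(i < n) u i ^+ 2.
Proof. by apply: sumr_ge0 => i _; exact: sqr_ge0. Qed.

Lemma l2norm_ge0 u : 0 <= l2norm u.
Proof. exact: sqrtr_ge0. Qed.

Lemma l2norm_sqr u : l2norm u ^+ 2 = \sum_(i < n) u i ^+ 2.
Proof. by rewrite sqr_sqrtr // sum_sqr_ge0. Qed.

Lemma l2norm_eq0 u : l2norm u = 0 -> forall i, u i = 0.
Proof.
move=> u0 i; have /eqP := l2norm_sqr u; rewrite u0 expr0n /= eq_sym.
rewrite psumr_eq0 => [/allP/(_ i)|j _]; last exact: sqr_ge0.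
by rewrite mem_index_enum sqrf_eq0 => /(_ isT)/eqP.
Qed.

Lemma eq_l2norm u v : u =1 v -> l2norm u = l2norm v.
Proof. by move=> uv; congr Num.sqrt; apply: eq_bigr => i _; rewrite uv. Qed.

Lemma l2norm0 : l2norm (fun _ : 'I_n => 0 : R) = 0.
Proof. by rewrite /l2norm big1 ?sqrtr0 // => i _; rewrite expr0n. Qed.

Lemma ler_l2norm u v : (forall i, 0 <= u i <= v i) -> l2norm u <= l2norm v.
Proof.
move=> uv; apply: ler_wsqrtr; apply: ler_sum => i _.
by have /andP[u0 uvi] := uv i; rewrite lerXn2r // nnegrE // (le_trans u0).
Qed.

Lemma l2normZ (c : R) u : 0 <= c -> l2norm (fun i => c * u i) = c * l2norm u.
Proof.
move=> c0; rewrite /l2norm -{2}(ger0_norm c0) -sqrtr_sqr -sqrtrM ?sqr_ge0 //.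
by congr Num.sqrt; rewrite mulr_sumr; apply: eq_bigr => i _; rewrite exprMn.
Qed.

Lemma cauchy_schwarz u v : \sum_(i < n) u i * v i <= l2norm u * l2norm v.
Proof.
have [u0|u0] := eqVneq (l2norm u) 0.
  by rewrite u0 mul0r big1 // => i _; rewrite (l2norm_eq0 u0) mul0r.
have [v0|v0] := eqVneq (l2norm v) 0.
  by rewrite v0 mulr0 big1 // => i _; rewrite (l2norm_eq0 v0) mulr0.
have up : 0 < l2norm u by rewrite lt_def u0 l2norm_ge0.
have vp : 0 < l2norm v by rewrite lt_def v0 l2norm_ge0.
have := sum_sqr_ge0 (fun i => l2norm v * u i - l2norm u * v i).
have -> : \sum_(i < n) (l2norm v * u i - l2norm u * v i) ^+ 2 =
    2 * (l2norm u * l2norm v) *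
      (l2norm u * l2norm v - \sum_(i < n) u i * v i).
  transitivity (l2norm v ^+ 2 * (\sum_(i < n) u i ^+ 2) +
      l2norm u ^+ 2 * (\sum_(i < n) v i ^+ 2) -
      2 * (l2norm u * l2norm v) * (\sum_(i < n) u i * v i)).
    rewrite !mulr_sumr -sumrN -!big_split /=.
    by apply: eq_bigr => i _; ring.
  by rewrite -!l2norm_sqr; ring.
by rewrite pmulr_rge0 ?subr_ge0 // !mulr_gt0.
Qed.

Lemma ler_l2normD u v : l2norm (fun i => u i + v i) <= l2norm u + l2norm v.
Proof.
rewrite -(@ler_pXn2r _ 2) ?nnegrE ?addr_ge0 ?l2norm_ge0 // l2norm_sqr.
have -> : \sum_(i < n) (u i + v i) ^+ 2 =
    l2norm u ^+ 2 + l2norm v ^+ 2 + 2 * (\sum_(i < n) u i * v i).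
  rewrite !l2norm_sqr mulr_sumr -!big_split /=.
  by apply: eq_bigr => i _; ring.
by have := cauchy_schwarz u v; lra.
Qed.

End L2norm.

(** * The product is W-hyperbolic *)

Lemma prod_dist_is_metric (R : realType) (n : nat) (X : 'I_n -> Type)
    (d : forall i : 'I_n, X i -> X i -> R) :
  (forall i, is_metric (d i)) -> is_metric (prod_dist d).
Proof.
move=> dm; split.
- by move=> x y; exact: l2norm_ge0.
- move=> x; rewrite -[RHS](l2norm0 R n).
  by apply: eq_l2norm => i; exact: metric_refl (dm i) _.
- move=> x y /l2norm_eq0 xy; apply: functional_extensionality_dep => i.
  exact: metric_pos (dm i) _ _ (xy i).
- by move=> x y; apply: eq_l2norm => i; exact: metric_symm (dm i) _ _.
- move=> y x z; apply: le_trans (ler_l2normD _ _); apply: ler_l2norm => i.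
  by rewrite (metric_ge0 (dm i)) (metric_tri (dm i)).
Qed.

(** A family of nonnegative reals bounded coordinatewise by convex
    combinations has its norm bounded by the convex combination of norms. *)
Lemma ler_l2norm_conv (R : realType) (n : nat) (u v w : 'I_n -> R) (l : R) :
  0 <= l <= 1 -> (forall i, 0 <= w i) ->
  (forall i, w i <= (1 - l) * u i + l * v i) ->
  l2norm w <= (1 - l) * l2norm u + l * l2norm v.
Proof.
move=> /andP[l0 l1] w0 wuv; rewrite -!l2normZ ?subr_ge0 //.
by apply: le_trans (ler_l2normD _ _); apply: ler_l2norm => i; rewrite w0 wuv.
Qed.

Lemma prod_is_W_hyperbolic (R : realType) (n : nat) (X : 'I_n -> Type)
    (d : forall i : 'I_n, X i -> X i -> R)
    (W : forall i : 'I_n, X i -> X i -> R -> X i) :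
  (forall i, is_W_hyperbolic (d i) (W i)) ->
  is_W_hyperbolic (prod_dist d) (prod_W W).
Proof.
move=> dW; have d_ge0 i := metric_ge0 (W_metric (dW i)); split.
- by apply: prod_dist_is_metric => i; exact: W_metric (dW i).
- move=> x y z l l01; apply: ler_l2norm_conv => // i.
  exact: W1 (dW i) _ _ _ _ l01.
- move=> x y l m l01 m01; rewrite -l2normZ //; apply: eq_l2norm => i.
  exact: W2 (dW i) _ _ _ _ l01 m01.
- move=> x y l l01; apply: functional_extensionality_dep => i.
  exact: W3 (dW i) _ _ _ l01.
- move=> x y z w l l01; apply: ler_l2norm_conv => // i.
  exact: W4 (dW i) _ _ _ _ _ l01.
Qed.

(** * Uniform convexity *)

Lemma midpoint_dist_le (R : realType) (T : Type) (d : T -> T -> R)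
    (W : T -> T -> R -> T) (x y a : T) :
  is_W_hyperbolic d W -> d (midpoint W x y) a <= (d x a + d y a) / 2.
Proof.
move=> dW; have dS := metric_symm (W_metric dW).
have l01 : 0 <= (1 / 2 : R) <= 1 by lra.
by have := W1 dW x y a l01; rewrite dS (dS x) (dS y) /midpoint; lra.
Qed.

Lemma midpoint_sqr_le (R : realType) (T : Type) (d : T -> T -> R)
    (W : T -> T -> R -> T) (x y a : T) :
  is_W_hyperbolic d W ->
  d (midpoint W x y) a ^+ 2 <= (d x a ^+ 2 + d y a ^+ 2) / 2.
Proof.
move=> dW; have := midpoint_dist_le x y a dW.
have := metric_ge0 (W_metric dW) (midpoint W x y) a.
by have := sqr_ge0 (d x a - d y a); nra.
Qed.

(** The gain over the inequality m^2 <= (p^2 + q^2) / 2, with p >= q: it comes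
    from the term (p - q)^2 / 4 if p - q >= h p, and from m <= (1 - h) p
    otherwise. *)
Lemma sqr_gain (R : realType) (p q m h : R) :
  0 <= q -> q <= p -> 0 < h <= 1 -> 0 <= m ->
  m <= (p + q) / 2 -> m <= (1 - h) * p ->
  m ^+ 2 <= (p ^+ 2 + q ^+ 2) / 2 - (h * p) ^+ 2 / 4.
Proof.
move=> q0 qp /andP[h0 h1] m0 mpq mhp; have p0 := le_trans q0 qp.
have [hp|hp] := leP (h * p) (p - q).
  have m2 : m ^+ 2 <= ((p + q) / 2) ^+ 2 by rewrite lerXn2r ?nnegrE //; lra.
  have : (h * p) ^+ 2 <= (p - q) ^+ 2.
    by rewrite lerXn2r ?nnegrE ?subr_ge0 // mulr_ge0 // ltW.
  by lra.
have hp0 : 0 <= (1 - h) * p by rewrite mulr_ge0 ?subr_ge0.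
have m2 : m ^+ 2 <= ((1 - h) * p) ^+ 2 by rewrite lerXn2r ?nnegrE.
have q2 : ((1 - h) * p) ^+ 2 <= q ^+ 2 by rewrite lerXn2r ?nnegrE //; lra.
have : 0 <= (h * (1 - h)) * p ^+ 2.
  by rewrite mulr_ge0 ?sqr_ge0 // mulr_ge0 ?subr_ge0 // ltW.
have : 0 <= h ^+ 2 * p ^+ 2 by rewrite mulr_ge0 ?sqr_ge0.
by lra.
Qed.

(** Uniform convexity is applied at the radius max (d x a) (d y a) <= r, where
    monotonicity of the modulus allows using its value at r. *)
Lemma midpoint_sqr_gain (R : realType) (T : Type) (d : T -> T -> R)
    (W : T -> T -> R -> T) (eta : R -> R -> R) (x y a : T) (r e : R) :
  is_W_hyperbolic d W -> is_UC_modulus d W eta -> monotone_modulus eta ->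
  0 < r -> 0 < e <= 2 -> d x a <= r -> d y a <= r -> e * r <= d x y ->
  d (midpoint W x y) a ^+ 2 <=
    (d x a ^+ 2 + d y a ^+ 2) / 2 - (eta r e * (e * r)) ^+ 2 / 16.
Proof.
move=> dW ucm mono r0 e02 xr yr xy.
have dM := W_metric dW; have /andP[e0 e2] := e02.
have /andP[h0 h1] := UC_modulus_range ucm r0 e02.
have xay : d x y <= d x a + d y a.
  by rewrite (metric_symm dM y a); exact: metric_tri dM _ _ _.
have x0 := metric_ge0 dM x a; have y0 := metric_ge0 dM y a.
have m0 := metric_ge0 dM (midpoint W x y) a.
have er0 : 0 < e * r by exact: mulr_gt0.
have mle := midpoint_dist_le x y a dW.
(* To be used with s the larger of the two distances to a; the triangle
     inequality gives e * r <= d x y <= 2 * s. *)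
have mod_le s : d x a <= s -> d y a <= s -> s <= r ->
    d (midpoint W x y) a <= (1 - eta r e) * s /\
    (eta r e * (e * r)) ^+ 2 / 16 <= (eta r e * s) ^+ 2 / 4.
  move=> xs ys sr; have s0 : 0 < s by lra.
  split.
    have exy : e * s <= d x y by apply: le_trans xy; rewrite ler_pM2l.
    apply: le_trans (UC_modulus_le ucm s0 e02 xs ys exy) _.
    by rewrite ler_pM2r // lerD2l lerN2; exact: mono.
  have : (eta r e * (e * r)) ^+ 2 <= (eta r e * (2 * s)) ^+ 2.
    by rewrite lerXn2r ?nnegrE ?ler_pM2l // ?mulr_ge0 //; lra.
  by lra.
have [yx|xy'] := leP (d y a) (d x a).
  have [mh hs] := mod_le _ (lexx _) yx xr.
  have h01 : 0 < eta r e <= 1 by rewrite h0.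
  by have := sqr_gain y0 yx h01 m0 mle mh; lra.
have [mh hs] := mod_le _ (ltW xy') (lexx _) yr.
have h01 : 0 < eta r e <= 1 by rewrite h0.
rewrite addrC in mle.
by have := sqr_gain x0 (ltW xy') h01 m0 mle mh; lra.
Qed.

Lemma coord_le_l2norm (R : realType) (n : nat) (u : 'I_n -> R) (i : 'I_n) :
  u i <= l2norm u.
Proof.
apply: le_trans (ler_norm _) _; rewrite -sqrtr_sqr; apply: ler_wsqrtr.
by rewrite (bigD1 i) //= lerDl; apply: sumr_ge0 => j _; exact: sqr_ge0.
Qed.

Lemma exists_large_coord (R : realType) (n : nat) (u : 'I_n -> R) (c : R) :
  (0 < n)%N -> (forall i, 0 <= u i) -> 0 < c -> c <= l2norm u ->
  exists i, c / n%:R <= u i.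
Proof.
move=> n0 u0 c0 cu; apply/existsP; apply: contraLR cu.
rewrite negb_exists => /forallP small; rewrite -ltNge.
have nR : 1 <= n%:R :> R by rewrite ler1n.
have nR0 : 0 < n%:R :> R by rewrite ltr0n.
rewrite -(@ltr_pXn2r _ 2) ?nnegrE ?l2norm_ge0 ?(ltW c0) // l2norm_sqr.
apply: (@lt_le_trans _ _ (\sum_(i < n) (c / n%:R) ^+ 2)).
  apply: ltr_sum => [|i _].
    by apply/hasP; exists (Ordinal n0); rewrite ?mem_index_enum.
  have := small i; rewrite -ltNge => ui.
  by rewrite ltrXn2r ?nnegrE // divr_ge0 ?ltW.
rewrite sumr_const card_ord -[X in X <= _]mulr_natr.
have -> : (c / n%:R) ^+ 2 * n%:R = c ^+ 2 / n%:R by field; rewrite gt_eqF.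
by rewrite ler_piMr ?sqr_ge0 // invf_le1.
Qed.

(** The modulus of the product space: e / n is the relative separation available
    in at least one coordinate, and the product over all coordinates is a
    positive lower bound of the moduli [eta i r (e / n)], all at most 1. *)
Definition prod_modulus (R : realType) (n : nat) (eta : 'I_n -> R -> R -> R)
    (r e : R) : R :=
  ((\prod_(i < n) eta i r (e / n%:R)) * (e / n%:R)) ^+ 2 / 32.

Section ProdModulus.
Variables (R : realType) (n : nat) (eta : 'I_n -> R -> R -> R).
Hypothesis n_gt0 : (0 < n)%N.
Hypothesis eta_range :
  forall i (r e : R), 0 < r -> 0 < e <= 2 -> 0 < eta i r e <= 1.

Lemma divn_range (e : R) : 0 < e <= 2 -> 0 < e / n%:R <= 2.
Proof.
move=> /andP[e0 e2]; rewrite divr_gt0 ?ltr0n //=; apply: le_trans e2.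
by rewrite ler_piMr ?(ltW e0) // invf_le1 ?ler1n ?ltr0n.
Qed.

Lemma prod_eta_range (r e : R) : 0 < r -> 0 < e <= 2 ->
  0 < \prod_(i < n) eta i r e <= 1.
Proof.
move=> r0 e02; rewrite prodr_gt0 => [|i _].
  by apply: prodr_ile1 => i _; have /andP[/ltW -> ->] := eta_range i r0 e02.
by have /andP[] := eta_range i r0 e02.
Qed.

Lemma prod_eta_le (r e : R) (i : 'I_n) : 0 < r -> 0 < e <= 2 ->
  \prod_(j < n) eta j r e <= eta i r e.
Proof.
move=> r0 e02; have /andP[h0 _] := eta_range i r0 e02.
rewrite (bigD1 i) //= ler_piMr ?(ltW h0) //; apply: prodr_ile1 => j _.
by have /andP[/ltW -> ->] := eta_range j r0 e02.
Qed.

Lemma prod_modulus_range (r e : R) : 0 < r -> 0 < e <= 2 ->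
  0 < prod_modulus eta r e <= 1.
Proof.
move=> r0 /divn_range e02; rewrite /prod_modulus.
have /andP[h0 h1] := prod_eta_range r0 e02; have /andP[e0 e2] := e02 => {e02}.
move: (\prod_(i < n) _) h0 h1 => h h0 h1; move: (e / _) e0 e2 => c c0 c2.
rewrite divr_gt0 ?exprn_gt0 ?mulr_gt0 ?ltr0n //=.
have hc : h * c <= 2 by rewrite -[leRHS]mul1r; apply: ler_pM => //; exact: ltW.
have hc0 : 0 <= h * c by rewrite ltW // mulr_gt0.
have : (h * c) ^+ 2 <= 2 ^+ 2 by rewrite lerXn2r ?nnegrE.
by lra.
Qed.

Lemma prod_modulus_monotone :
  (forall i, monotone_modulus (eta i)) -> monotone_modulus (prod_modulus eta).
Proof.
move=> mono r s e r0 s0 sr /divn_range e02; have /andP[e0 _] := e02.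
have /andP[hr0 _] := prod_eta_range r0 e02.
have /andP[hs0 _] := prod_eta_range s0 e02.
rewrite /prod_modulus ler_pM2r ?invr_gt0 ?ltr0n //.
have [hre hse] := (mulr_gt0 hr0 e0, mulr_gt0 hs0 e0).
rewrite lerXn2r ?nnegrE ?(ltW hre) ?(ltW hse) // ler_pM2r //.
apply: ler_prod => i _; rewrite mono // andbT.
by have /andP[/ltW] := eta_range i r0 e02.
Qed.

End ProdModulus.

Lemma prod_is_UC_modulus (R : realType) (n : nat) (X : 'I_n -> Type)
    (d : forall i : 'I_n, X i -> X i -> R)
    (W : forall i : 'I_n, X i -> X i -> R -> X i)
    (eta : 'I_n -> R -> R -> R) :
  (0 < n)%N -> (forall i, is_W_hyperbolic (d i) (W i)) ->
  (forall i, is_UC_modulus (d i) (W i) (eta i)) ->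
  (forall i, monotone_modulus (eta i)) ->
  is_UC_modulus (prod_dist d) (prod_W W) (prod_modulus eta).
Proof.
move=> n0 dW ucm mono.
have eta01 i r e := @UC_modulus_range _ _ _ _ _ (ucm i) r e.
have d_ge0 i := metric_ge0 (W_metric (dW i)).
split=> [|r e a x y r0 e02 xr yr xy]; first exact: prod_modulus_range.
have c02 := divn_range n0 e02; have /andP[c0 _] := c02.
have /andP[e0 _] := e02.
have /andP[k0 k1] := prod_modulus_range n0 eta01 r0 e02.
have [i xyi] : exists i, e * r / n%:R <= d i (x i) (y i).
  by apply: exists_large_coord xy; rewrite ?mulr_gt0.
rewrite mulrAC in xyi.
have xri := le_trans (coord_le_l2norm (fun j => d j (x j) (a j)) i) xr.
have yri := le_trans (coord_le_l2norm (fun j => d j (y j) (a j)) i) yr.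
have gain := midpoint_sqr_gain (dW i) (ucm i) (mono i) r0 c02 xri yri xyi.
have gain_le : 2 * prod_modulus eta r e * r ^+ 2 <=
    (eta i r (e / n%:R) * (e / n%:R * r)) ^+ 2 / 16.
  have /andP[p0 _] := prod_eta_range eta01 r0 c02.
  have pi := prod_eta_le eta01 i r0 c02.
  rewrite /prod_modulus; set P := \prod_(j < n) _ in p0 pi *.
  have : (P * (e / n%:R * r)) ^+ 2 <= (eta i r (e / n%:R) * (e / n%:R * r)) ^+ 2.
    have cr0 : 0 < e / n%:R * r by exact: mulr_gt0.
    have i0 := lt_le_trans p0 pi.
    by rewrite lerXn2r ?nnegrE ?(ler_pM2r cr0) // mulr_ge0 ?ltW.
  by lra.
have xs : \sum_(j < n) d j (x j) (a j) ^+ 2 <= r ^+ 2.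
  by rewrite -l2norm_sqr lerXn2r ?nnegrE ?l2norm_ge0 // ltW.
have ys : \sum_(j < n) d j (y j) (a j) ^+ 2 <= r ^+ 2.
  by rewrite -l2norm_sqr lerXn2r ?nnegrE ?l2norm_ge0 // ltW.
have ms : prod_dist d (midpoint (prod_W W) x y) a ^+ 2 <=
    (1 - 2 * prod_modulus eta r e) * r ^+ 2.
  rewrite [X in X <= _]l2norm_sqr.
  have rest : \sum_(j < n | j != i) d j (midpoint (W j) (x j) (y j)) (a j) ^+ 2
      <= (\sum_(j < n | j != i) d j (x j) (a j) ^+ 2 +
          \sum_(j < n | j != i) d j (y j) (a j) ^+ 2) / 2.
    rewrite -big_split /= mulr_suml; apply: ler_sum => j _.
    exact: midpoint_sqr_le.
  rewrite (bigD1 i) //= in xs; rewrite (bigD1 i) //= in ys.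
  rewrite (bigD1 i) //=.
  by move: rest gain gain_le xs ys; rewrite /midpoint /prod_W; lra.
(* With k the modulus, 1 - 2 k <= (1 - k)^2. *)
rewrite -(@ler_pXn2r _ 2) ?nnegrE ?l2norm_ge0 // ?pmulr_lge0 ?subr_ge0 //.
apply: le_trans ms _; rewrite exprMn ler_wpM2r ?sqr_ge0 //.
by have := sqr_ge0 (prod_modulus eta r e); lra.
Qed.

Theorem proposition3p3 (R : realType) (n : nat) (hn : (0 < n)%N)
  (X : 'I_n -> Type)
  (d : forall i : 'I_n, X i -> X i -> R)
  (W : forall i : 'I_n, X i -> X i -> R -> X i)
  (hX : forall i : 'I_n, is_UCW_hyperbolic (d i) (W i)) :
  is_UCW_hyperbolic (prod_dist d) (prod_W W).
Proof.
have dW i := (hX i).1.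
have [eta ucm] := fin_all_exists (fun i => (hX i).2).
split; first exact: prod_is_W_hyperbolic.
exists (prod_modulus eta); split.
  by apply: prod_is_UC_modulus => // i; have [] := ucm i.
apply: prod_modulus_monotone => // i; last by have [] := ucm i.
exact: UC_modulus_range (ucm i).1.
Qed.
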